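(* Let $X$ be a regular $T_1$ topological space. The following statements are equivalent. (1) $(CL(X),\tau_F)$ is metrizable. (2) $(CL(X),\tau_F)$ is a $\gamma$-space. (3) $(CL(X),\tau_F)$ is a $D_0$-space. (4) $(\mathcal{K}(X),\tau_F)$ is a $D_0$-space. (5) $(\mathcal{F}(X),\tau_F)$ is a $D_0$-space. (6) $(\mathcal{F}_2(X),\tau_F)$ is a $D_0$-space. (7) $X$ is locally compact, separable and metrizable.
   Context: $CL(X)$ is the set of all nonempty closed subsets of $X$; $\mathcal{K}(X)$ is the set of all nonempty compact subsets of $X$; $\mathcal{F}(X)$ is the set of all nonempty finite subsets of $X$; $\mathcal{F}_2(X)=\{A\subset X: A\neq\emptyset, |A|\leq 2\}$. The Fell topology $\tau_F$ on $CL(X)$ is generated by the subbase consisting of the sets $U^-=\{H\in CL(X): H\cap U\neq\emptyset\}$ for $U$ nonempty open in $X$, and the sets $(K^c)^+=\{H\in CL(X): H\subset X\setminus K\}$ for $K$ compact in $X$, $K\neq X$. On subsets of $CL(X)$, $\tau_F$ denotes the subspace topology. A space $Y$ is a $D_0$-space if every compact subset $A$ of $Y$ has a countable local base, i.e. there is a countable family of open sets containing $A$ such that every open set containing $A$ contains a member of the family. A space $(Y,\tau)$ is a $\gamma$-space if there is a function $g:\omega\times Y\to\tau$ such that (i) for each $y\in Y$, $\{g(n,y): n\in\omega\}$ is a base at $y$; (ii) for each $n\in\omega$ and $x\in Y$ there exists $m\in\omega$ such that $y\in g(m,x)$ implies $g(m,y)\subset g(n,x)$. *)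

(* Defs.v *)
From HB Require Import structures.
From mathcomp Require Import all_boot all_order all_algebra.
From mathcomp Require Import all_classical all_reals topology.

Set Implicit Arguments.
Unset Strict Implicit.
Unset Printing Implicit Defensive.

Local Open Scope classical_set_scope.

Definition CL (X : topologicalType) : Type :=
  set_type [set H : set X | H !=set0 /\ closed H].

HB.instance Definition _ (X : topologicalType) := Choice.on (CL X).

Definition hit (X : topologicalType) (U : set X) : set (CL X) :=
  [set H | \val H `&` U !=set0].

Definition miss (X : topologicalType) (K : set X) : set (CL X) :=
  [set H | \val H `<=` ~` K].

Definition fell_subbase (X : topologicalType) : set (set (CL X)) :=
  [set hit U | U in [set U : set X | open U /\ U !=set0]] `|`
  [set miss K | K in [set K : set X | compact K /\ K <> [set: X]]].

(* The Fell topology, as the canonical topology of [CL X]: the subbase is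
   indexed by itself. *)
HB.instance Definition _ (X : topologicalType) :=
  @isSubBaseTopological.Build (CL X) (set (CL X)) (@fell_subbase X) id.

(* The three families below are subsets of [CL X], and [set_type] of each
   carries the subspace topology. They contain all nonempty compact (resp.
   finite, at most two-element) subsets of X as soon as such sets are closed,
   which holds in particular when X is regular and T1. *)
Definition compact_hyper (X : topologicalType) : set (CL X) :=
  [set H | compact (\val H)].

Definition finite_hyper (X : topologicalType) : set (CL X) :=
  [set H | finite_set (\val H)].

Definition le2_hyper (X : topologicalType) : set (CL X) :=
  [set H | (\val H #<= `I_2)%card].

Definition separable (T : topologicalType) : Prop :=
  exists2 D : set T, countable D & dense D.

(* [m] ranges over all metric structures on the carrier of [T]; such a
   structure brings its own topology, which is required to be that of [T]. *)
Definition metrizable (R : realType) (T : topologicalType) : Prop :=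
  exists m : Metric R T, @open (Metric.Pack m) = @open T.

Definition D0_space (T : topologicalType) : Prop :=
  forall A : set T, compact A ->
    exists B : set (set T),
      [/\ countable B,
          forall U, B U -> open U /\ A `<=` U &
          forall V, open V -> A `<=` V -> exists2 U, B U & U `<=` V].

Definition gamma_space (T : topologicalType) : Prop :=
  exists g : nat -> T -> set T,
    [/\ forall n y, open_nbhs y (g n y),
        forall y V, open_nbhs y V -> exists n, g n y `<=` V &
        forall n x, exists m, forall y, g m x y -> g m y `<=` g n x].

(* Main.v *)
Require Import Defs.
From HB Require Import structures.
From mathcomp Require Import all_boot all_order all_algebra finmap.
From mathcomp Require Import all_classical all_reals topology normedtype.
From mathcomp Require Import lra.

(** The implications from metrizability down to [F_2(X)] being a [D_0]-space are
    formal: balls of radius [1 / (n + 1)] make a metrizable space a gamma-space,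
    a compactness argument shows that gamma-spaces are [D_0]-spaces
    ([gamma_D0]), and the [D_0] property is hereditary ([D0_initial]).

    The heart of the matter is that [F_2(X)] being [D_0] forces [X] to be
    locally compact and second countable. A countable local base at the
    one-point family [{{x}}] yields a countable base at [x] and, because the
    set [{x, y}] is close to [{x}] unless [y] lies in the compact set to be
    missed, a sequence of compact sets exhausting the compact subsets of
    [X \ {x}] ([D0_pair_point_base]). First countability then makes
    the interiors of these compact sets cover [X \ {x}]
    ([hemicompact_nbhs]); using two points, countably many compact interiors
    cover [X]. For a compact set [C], the family of the singletons [{c}] with
    [c] in [C] is compact; a countable local base at it gives, much as a
    countable base of the uniformity of [C] would, finite covers of [C] which
    together form a countable base on [C] ([D0_pair_compact_base]).

    Conversely, a second countable locally compact Hausdorff space carries a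
    sequence of continuous functions [f_n], valued in [0, 1] and with compact
    positive superlevel sets, that separates points from closed sets
    ([countable_bumps]). These functions generate the topology of [X], and the
    functions [H |-> sup_H f_n] generate the Fell topology of [CL(X)]; since a
    T1 topology generated by a sequence of bounded functions is metrizable
    ([metrizable_of_functions]), both [X] and [CL(X)] are metrizable. *)

Set Implicit Arguments.
Unset Strict Implicit.
Unset Printing Implicit Defensive.
Import Order.TTheory GRing.Theory Num.Theory.
Import numFieldNormedType.Exports.

Local Open Scope classical_set_scope.
Local Open Scope ring_scope.

(** * Distances and metrization by sequences of functions *)

(** A distance function: the axioms of a metric, without its topology. *)
Definition is_dist (R : realType) (T : Type) (d : T -> T -> R) :=
  [/\ forall x, d x x = 0, forall x y, d x y = 0 -> x = y,
      forall x y, d x y = d y x & forall y x z, d x z <= d x y + d y z].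

(** Metrizability stated through a bare distance function whose balls generate
    the neighbourhoods, with no second topology on the carrier. *)
Lemma metrizableP (R : realType) (T : topologicalType) :
  metrizable R T <->
  exists2 d : T -> T -> R, is_dist d &
    forall x V, nbhs x V <-> exists2 e, 0 < e & [set y | d x y < e] `<=` V.
Proof.
split=> [[m mE]|[d [dxx d0 dC dT] dE]].
  pose M := Metric.Pack m; exists (@mdist R M).
    split.
    - exact: (@mdistxx R M).
    - exact: (@mdist_positivity R M).
    - exact: (@metric_sym R M).
    - by move=> y x z; exact: (@metric_triangle R M).
  move=> x V.
  have -> : nbhs x V = @nbhs M M x V.
    by rewrite !nbhsE /open_nbhs mE.
  by rewrite -metricType_numDomainType.filter_from_mdist_nbhs.
pose M : metricType R := HB.pack (T : Type) (Choice.on T)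
  (isMetric.Build R T dxx d0 dC dT).
exists (Metric.class M).
have nE (x : T) : @nbhs M M x = @nbhs T T x.
  apply/seteqP; split=> V;
    rewrite -metricType_numDomainType.filter_from_mdist_nbhs.
    by move=> [e e0 eV]; apply/dE; exists e.
  by move=> /dE [e e0 eV]; exists e.
apply/seteqP; split=> V; rewrite !openE => oV x /oV; rewrite /interior.
  by rewrite nE.
by rewrite -nE.
Qed.

Section dist_of_functions.
Variables (R : realType) (T : Type) (f : nat -> T -> R).
Hypothesis f01 : forall n x, 0 <= f n x <= 1.

(** The weighted sup-distance associated with a sequence of [0, 1]-valued
    functions; the weight of the [n]-th function is [1 / (n + 1)]. *)
Definition fun_dist x y := sup (range (fun n => `|f n x - f n y| / n.+1%:R)).

Let termle n x y : `|f n x - f n y| / n.+1%:R <= 1.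
Proof.
rewrite ler_pdivrMr// mul1r (@le_trans _ _ 1) ?ler1n//.
by have := f01 n x; have := f01 n y; rewrite ler_norml; lra.
Qed.

Let ub_terms x y : has_ubound (range (fun n => `|f n x - f n y| / n.+1%:R)).
Proof. by exists 1 => _ [n _ <-]; exact: termle. Qed.

Lemma fun_dist_ge n x y : `|f n x - f n y| / n.+1%:R <= fun_dist x y.
Proof. exact: (ub_le_sup (ub_terms x y) (ex_intro2 _ _ n I erefl)). Qed.

Lemma fun_dist_le x y e :
  (forall n, `|f n x - f n y| / n.+1%:R <= e) -> fun_dist x y <= e.
Proof.
move=> fe; apply: ge_sup; first by eexists; exists 0%N.
by move=> _ [n _ <-].
Qed.

Lemma fun_dist_ge0 x y : 0 <= fun_dist x y.
Proof. by apply: le_trans (fun_dist_ge 0 x y); rewrite divr_ge0. Qed.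

Lemma fun_dist_is_dist : (forall x y, (forall n, f n x = f n y) -> x = y) ->
  is_dist fun_dist.
Proof.
move=> fI; split.
- move=> x; apply/eqP; rewrite eq_le fun_dist_ge0 andbT.
  by apply: fun_dist_le => n; rewrite subrr normr0 mul0r.
- move=> x y xy0; apply: fI => n; apply/eqP; rewrite -subr_eq0 -normr_le0.
  by have := fun_dist_ge n x y; rewrite xy0 ler_pdivrMr// mul0r.
- move=> x y; rewrite /fun_dist; under eq_fun do rewrite distrC.
  by [].
- move=> y x z; apply: fun_dist_le => n.
  apply: le_trans (lerD (fun_dist_ge n x y) (fun_dist_ge n y z)).
  rewrite -mulrDl ler_pM2r ?invr_gt0//.
  by rewrite (le_trans _ (ler_normD _ _))// addrA subrK.
Qed.

End dist_of_functions.

(** A T1 space whose topology is initial for a sequence of [0, 1]-valued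
    functions is metrizable. *)
Lemma metrizable_of_functions (R : realType) (T : topologicalType)
    (f : nat -> T -> R) :
  accessible_space T ->
  (forall n x, 0 <= f n x <= 1) ->
  (forall n, continuous (f n)) ->
  (forall x V, nbhs x V -> exists N e, 0 < e /\
     forall y, (forall n, (n < N)%N -> `|f n x - f n y| < e) -> V y) ->
  metrizable R T.
Proof.
move=> T1 f01 fc fV; apply/metrizableP; exists (fun_dist f).
  apply: fun_dist_is_dist => // x y xy; apply: contrapT => /eqP/T1[A [oA]].
  rewrite !inE => Ax Ay.
  have /fV[N [e [e0]]] : nbhs x A by exact: open_nbhs_nbhs.
  by move=> NA; apply: Ay; apply: NA => n _; rewrite xy subrr normr0.
move=> x V; split.
- move=> /fV[N [e [e0 NV]]]; exists (e / N.+1%:R); first by rewrite divr_gt0.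
  move=> y /= xy; apply: NV => n nN.
  have := le_lt_trans (fun_dist_ge f01 n x y) xy.
  rewrite ltr_pdivrMr// => /lt_le_trans; apply.
  rewrite -mulrA; apply: ler_piMr; first exact: ltW.
  by rewrite mulrC ler_pdivrMr// mul1r ler_nat leqW.
- move=> [e e0 eV]; apply: filterS eV _.
  (* From index N on the weights are below e / 2, so only the first N
     functions have to be controlled. *)
  pose N := Num.bound (2 / e).
  have Ne : N.+1%:R^-1 < e / 2.
    rewrite invf_plt ?posrE ?divr_gt0// invf_div.
    apply: lt_trans (archi_boundP _) _; first by rewrite divr_ge0 ?ltW.
    by rewrite ltr_nat.
  have : \forall y \near x, forall n, (n < N)%N -> `|f n x - f n y| < e / 2.
    elim: N {Ne} => [|N IH]; first by apply: nearW.
    have fN : \forall y \near x, `|f N x - f N y| < e / 2.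
      by have /cvgrPdist_lt := fc N x; apply; rewrite divr_gt0.
    near=> y; move=> n; rewrite ltnS leq_eqVlt => /orP[/eqP->|].
      by near: y.
    by move: n; near: y.
  apply: filterS => y fy /=.
  apply: (@le_lt_trans _ _ (e / 2)); last by lra.
  apply: fun_dist_le => n; have [nN|Nn] := ltnP n N.
    rewrite ler_pdivrMr// (le_trans (ltW (fy _ nN)))// ler_peMr ?ler1n//.
    by rewrite divr_ge0// ltW.
  rewrite (@le_trans _ _ (n.+1%:R^-1))//.
    rewrite ler_piMl ?invr_ge0//.
    by have := f01 n x; have := f01 n y; rewrite ler_norml; lra.
  rewrite (le_trans _ (ltW Ne))// lef_pV2 ?posrE// ler_nat ltnS//.
Unshelve. all: by end_near. Qed.

(** * Metrizable spaces, gamma-spaces and [D_0]-spaces *)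

Lemma metrizable_gamma (R : realType) (T : topologicalType) :
  metrizable R T -> gamma_space T.
Proof.
move=> /metrizableP[d [dxx _ _ dT] dE].
exists (fun n y => [set z | d y z < n.+1%:R^-1]); split.
- move=> n y; split; last by rewrite /= dxx invr_gt0.
  rewrite openE => z /= yz; apply/dE; exists (n.+1%:R^-1 - d y z).
    by rewrite subr_gt0.
  move=> t /= zt; apply: le_lt_trans (dT z y t) _.
  by rewrite addrC -ltrBrDr.
- move=> y V /open_nbhs_nbhs /dE[e e0 eV].
  have [n ne] : exists n, n.+1%:R^-1 < e.
    exists (Num.bound e^-1); rewrite invf_plt ?posrE//.
    apply: lt_trans (archi_boundP _) _; first by rewrite invr_ge0 ltW.
    by rewrite ltr_nat.
  by exists n => z /= yz; apply: eV; exact: lt_trans yz ne.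
- move=> n x; exists (2 * n + 1)%N => y /= xy z /= yz.
  have m2 : (2 * n + 1).+1%:R^-1 = n.+1%:R^-1 / 2 :> R.
    by rewrite -invfM -natrM; congr (_%:R^-1); rewrite mulnC addn1 mulSn.
  rewrite m2 in xy yz.
  by rewrite (le_lt_trans (dT y x z))// [ltRHS]splitr ltrD.
Qed.

Lemma countable_range (T : Type) (A : set T) :
  countable A -> A !=set0 -> exists u : nat -> T, range u = A.
Proof.
move=> cA [a Aa].
have [A0|/unsquash u] := pfcard_geP cA; first by move: Aa; rewrite A0.
exists u; apply/seteqP; split=> [_ [n _ <-]|x /(@surj _ _ _ _ u)[n _ <-]].
  exact: funS.
by exists n.
Qed.

Lemma open_bigcap_ltn (T : topologicalType) (V : nat -> set T) n :
  (forall i, open (V i)) -> open (\bigcap_(i < n) V i).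
Proof.
move=> oV; rewrite bigcap_mkord; elim/big_ind : _ => //.
  exact: openT.
exact: openI.
Qed.

(** Finite subcovers, for covers by one open neighbourhood of each point and
    with no base point on the space. *)
Lemma compact_pointwise_cover (T : topologicalType) (A : set T)
    (V : T -> set T) : compact A -> (forall x, A x -> open_nbhs x (V x)) ->
  exists s : seq T, (forall x, x \in s -> A x) /\
    forall y, A y -> exists2 x, x \in s & V x y.
Proof.
move=> cA AV; apply: contrapT => nocover.
(* If no finite list covers, the complements of the finite unions generate a
   proper filter on A, which can have no cluster point in A. *)
pose F := filter_from [set s : seq T | forall x, x \in s -> A x]
  (fun s => A `&` [set y | forall x, x \in s -> ~ V x y]).
have FF : ProperFilter F.
  apply: filter_from_proper.
    apply: filter_from_filter; first by exists [::].
    move=> s t sA tA; exists (s ++ t).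
      by move=> x; rewrite mem_cat => /orP[/sA|/tA].
    move=> y /= [Ay nst]; split; split=> // x xs; apply: nst.
      by rewrite mem_cat xs.
    by rewrite mem_cat xs orbT.
  move=> s sA; apply: contrapT => /nonemptyPn s0; apply: nocover.
  exists s; split=> // y Ay; apply: contrapT => nsy.
  have : set0 y by rewrite -s0; split=> // x xs Vxy; apply: nsy; exists x.
  by [].
have [|p [Ap clFp]] := cA F FF; first by exists [::] => // y [].
have Fp : F (A `&` [set y | forall x, x \in [:: p] -> ~ V x y]).
  by exists [:: p] => // x; rewrite inE => /eqP ->.
have [y [[_ npy] Vpy]] := clFp _ _ Fp (open_nbhs_nbhs (AV p Ap)).
by apply: (npy p) Vpy; rewrite inE.
Qed.

(** The sets [G n], unions over [x] in the compact set of the intersections of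
    the first [n + 1] neighbourhoods of [x], are a local base at that set. *)
Lemma gamma_D0 (T : topologicalType) : gamma_space T -> D0_space T.
Proof.
move=> [g [go gb gg]] A cA.
pose G n := \bigcup_(x in A) (\bigcap_(i < n.+1) g i x).
exists (range G); split.
- exact: card_image_le.
- move=> _ [n _ <-]; split=> [|x Ax].
    apply: bigcup_open => x _; apply: open_bigcap_ltn => i.
    by have [] := go i x.
  by exists x => // i _; have [] := go i x.
- move=> V oV AV.
  have /choice[m mV] x : exists m, A x -> forall y, g m x y -> g m y `<=` V.
    have [Ax|nAx] := pselect (A x); last by exists 0%N.
    have [n gV] : exists n, g n x `<=` V by apply: gb; split => //; exact: AV.
    have [m gm] := gg n x; exists m => _ y /gm; move/subset_trans; exact.
  have [|s [sA As]] := @compact_pointwise_cover _ A (fun x => g (m x) x) cA.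
    by move=> x _; exact: go.
  exists (G (\max_(x <- s) m x)%N); first by exists (\max_(x <- s) m x)%N.
  move=> z [y /As[x xs xy] yz]; apply: (mV x (sA x xs) y xy).
  by apply: yz => /=; rewrite ltnS; exact: leq_bigmax_seq.
Qed.

(** The property passes to any space carrying an initial topology along a map,
    in particular to subspaces. *)
Lemma D0_initial (S T : topologicalType) (f : S -> T) : continuous f ->
  (forall U, open U -> exists2 V, open V & f @^-1` V = U) ->
  D0_space T -> D0_space S.
Proof.
move=> fc fo D0T A cA.
have [|B [cB Bo BV]] := D0T (f @` A).
  by apply: continuous_compact => //; exact: continuous_subspaceT.
exists [set f @^-1` U | U in B]; split.
- exact: sub_countable (card_image_le _ _) cB.
- move=> _ [U /Bo[oU AU] <-]; split; last by move=> x Ax; apply: AU; exists x.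
  by move/continuousP : fc; exact.
- move=> _ /fo[V oV <-] AV.
  have [|U BU UV] := BV _ oV; first by move=> _ [x Ax <-]; exact: AV.
  by exists (f @^-1` U); [exists U|move=> x /UV].
Qed.

Lemma D0_set_type (T : topologicalType) (A : set T) :
  D0_space T -> D0_space (set_type A).
Proof.
apply: (@D0_initial (set_type A) T val); first exact: initial_continuous.
by move=> _ [V oV <-]; exists V.
Qed.

Lemma D0_set_typeS (T : topologicalType) (A B : set T) : A `<=` B ->
  D0_space (set_type B) -> D0_space (set_type A).
Proof.
move=> AB; pose f (x : set_type A) : set_type B :=
  SigSub (mem_set (AB _ (set_mem (valP x)))).
have fo V : f @^-1` (val @^-1` V) = val @^-1` V by [].
apply: (@D0_initial (set_type A) (set_type B) f).
  apply/continuousP => _ [V oV <-].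
  by exists V.
by move=> _ [V oV <-]; exists (val @^-1` V) => //; exists V.
Qed.

(** * The Fell topology *)

Lemma regular_T1_hausdorff (X : topologicalType) :
  @regular_space X -> @accessible_space X -> hausdorff_space X.
Proof.
move=> Xreg XT1; rewrite open_hausdorff => x y xy.
have ny : [set y] x -> False by move=> /= e; rewrite e eqxx in xy.
have [U [V [oU oV Ux Vy UV]]] :=
  (regular_openP x).1 (Xreg x) _ (accessible_closed_set1 XT1 (x := y)) ny.
exists (U, V) => /=; first by rewrite !inE; split => //; exact: Vy.
by split => //; apply/eqP.
Qed.

Section fell.
Variable X : topologicalType.
Implicit Types (U K : set X) (H : CL X).

Lemma fell_subbase_open S : @fell_subbase X S -> open S.
Proof.
move=> bS; exists [set S]; last by rewrite bigcup_set1.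
move=> _ ->; exists [fset S]%fset.
  by move=> B /fset1P ->; exact/mem_set.
by rewrite set_fset1 bigcap_set1.
Qed.

(** To bound the neighbourhood filter of [H] it suffices to look at the subbasic
    sets containing [H]. *)
Lemma fell_nbhs_sub (H : CL X) (F : set_system (CL X)) : Filter F ->
  (forall U, open U -> \val H `&` U !=set0 -> F (hit U)) ->
  (forall K, compact K -> \val H `<=` ~` K -> F (miss K)) ->
  nbhs H `<=` F.
Proof.
move=> FF Fhit Fmiss A; rewrite nbhsE => -[_ [[B sB <-] [C BC CH]] sBA].
apply: filterS sBA _; apply: (@filterS _ _ _ C); first by move=> ? ?; exists C.
have /sB[D sD DC] := BC; rewrite -DC; apply: filter_bigI => E DE.
have HE : E H by move: CH; rewrite -DC => /(_ _ DE).
have /set_mem[[U [oU _] UE]|[K [cK _] KE]] := sD _ DE.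
  by rewrite -UE; apply: Fhit => //; move: HE; rewrite -UE.
by rewrite -KE; apply: Fmiss => //; move: HE; rewrite -KE.
Qed.

Lemma CL_neq0 H : \val H !=set0.
Proof. by have /set_mem[] := valP H. Qed.

Lemma CL_closed H : closed (\val H).
Proof. by have /set_mem[] := valP H. Qed.

(** The restrictions in the subbase are immaterial: the excluded sets [hit set0]
    and [miss setT] are empty, since the members of [CL X] are nonempty. *)
Lemma open_hit U : open U -> open (hit U).
Proof.
move=> oU; have [U0|/set0P U0] := eqVneq U set0.
  rewrite (_ : hit U = set0); first exact: open0.
  by rewrite -subset0 => H [x []]; rewrite U0.
by apply: fell_subbase_open; left; exists U.
Qed.

Lemma open_miss K : compact K -> open (miss K).
Proof.
move=> cK; have [KT|KT] := pselect (K = [set: X]).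
  rewrite (_ : miss K = set0); first exact: open0.
  rewrite -subset0 => H HK; have [x Hx] := CL_neq0 H.
  by have := HK x Hx; rewrite KT; apply.
by apply: fell_subbase_open; right; exists K.
Qed.

Lemma CL_inj H H' : \val H = \val H' -> H = H'.
Proof. exact: val_inj. Qed.

Lemma CL_accessible : accessible_space (CL X).
Proof.
move=> H H' HH'.
have [HsubH'|] := pselect (\val H `<=` \val H').
  have [y [H'y nHy]] : exists y, \val H' y /\ ~ \val H y.
    apply: contrapT => nex; case/eqP: HH'; apply: CL_inj.
    apply/seteqP; split=> // y H'y; apply: contrapT => nHy.
    by apply: nex; exists y.
  exists (miss [set y]); rewrite !inE; split.
  - by apply: open_miss; exact: compact_set1.
  - by move=> z Hz /= zy; apply: nHy; rewrite -zy.
  - by move=> /(_ y H'y); apply.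
move=> /existsNP[x /not_implyP[Hx nH'x]].
exists (hit (~` \val H')); rewrite !inE; split.
- by apply: open_hit; rewrite openC; exact: CL_closed.
- by exists x.
- by move=> [y []].
Qed.

End fell.

(** * Sets with at most two elements *)

Section pairs.
Variable X : topologicalType.
Hypothesis XT1 : @accessible_space X.

Lemma pair_closed (x y : X) : closed [set x; y].
Proof. exact: (accessible_finite_set_closed.1 XT1 _ (finite_set2 x y)). Qed.

(** The closed set [{x, y}] as a point of the hyperspace. *)
Definition pairCL (x y : X) : CL X :=
  SigSub (mem_set (conj (ex_intro [set x; y] x (or_introl erefl))
    (@pair_closed x y))).

Lemma pairCL_le2 (x y : X) : @le2_hyper X (pairCL x y).
Proof.
rewrite /le2_hyper /=.
have xyE : [set x; y] `<=` (fun n => if n is 0%N then x else y) @` `I_2.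
  by move=> z [] ->; [exists 0%N|exists 1%N].
exact: card_le_trans (subset_card_le xyE) (card_image_le _ _).
Qed.

(** The closed set [{x, y}] as a point of the space of sets with at most two
    elements. *)
Definition pair_le2 (x y : X) : set_type (@le2_hyper X) :=
  SigSub (mem_set (pairCL_le2 x y)).

(** Around [{c}] the Fell topology has a base made of one hit set and one miss
    set. *)
Lemma nbhs_singleCL (c : X) (O : set (CL X)) : nbhs (pairCL c c) O ->
  exists U K, [/\ open_nbhs c U, compact K, ~ K c &
    forall H : CL X, \val H `&` U !=set0 -> \val H `<=` ~` K -> O H].
Proof.
pose F := [set O : set (CL X) |
  exists U K, [/\ open_nbhs c U, compact K, ~ K c &
    forall H : CL X, \val H `&` U !=set0 -> \val H `<=` ~` K -> O H]].
apply: (@fell_nbhs_sub X _ F).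
- split.
  + exists setT, set0; split => //; first exact: open_nbhsT.
    exact: compact0.
  + move=> P Q [U [K [oU cK Kc PUK]]] [U' [K' [oU' cK' Kc' QUK]]].
    exists (U `&` U'), (K `|` K'); split.
    * exact: open_nbhsI.
    * exact: compactU.
    * by case.
    * move=> H [x [Hx [Ux U'x]]] HK; split.
        by apply: PUK; [exists x|move=> z /HK nK Kz; apply: nK; left].
      by apply: QUK; [exists x|move=> z /HK nK Kz; apply: nK; right].
  + move=> P Q PQ [U [K [oU cK Kc PUK]]]; exists U, K; split=> // H HU HK.
    exact/PQ/PUK.
- move=> U oU [x [/= xc Ux]]; exists U, set0; split => //.
  + by split=> //; case: xc => <-.
  + exact: compact0.
- move=> K cK cnK; exists setT, K; split=> //; first exact: open_nbhsT.
  exact: (cnK c (or_introl erefl)).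
Qed.

Hypothesis XT2 : hausdorff_space X.

Lemma singleCL_continuous : continuous (fun c => pairCL c c).
Proof.
move=> c; apply: fell_nbhs_sub.
- move=> U oU [x [/= xc Ux]]; have Uc : U c by case: xc => <-.
  have : nbhs c U by exact: open_nbhs_nbhs.
  by apply: filterS => y Uy; exists y; split => //; left.
- move=> K cK cnK.
  have : nbhs c (~` K).
    apply: open_nbhs_nbhs; split; last exact: (cnK c (or_introl erefl)).
    by rewrite openC; exact: compact_closed.
  by apply: filterS => y nKy z /= [] ->.
Qed.


(** The local base at the compact family of singletons [{c}], [c] in [C],
    rephrased as a sequence of relations on [X]: [N n y z] says that [{y, z}]
    belongs to the [n]-th basic set. *)
Lemma D0_pair_base (C : set X) :
  D0_space (set_type (@le2_hyper X)) -> compact C ->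
  exists N : nat -> X -> X -> Prop,
    (forall n c, C c -> exists U K, [/\ open_nbhs c U, compact K, ~ K c &
       forall y z, U y \/ U z -> ~ K y -> ~ K z -> N n y z]) /\
    (forall V : set (CL X), open V -> (forall c, C c -> V (pairCL c c)) ->
       exists n, forall y z, N n y z -> V (pairCL y z)).
Proof.
move=> D0 cC; pose A := (fun c => pair_le2 c c) @` C.
have [|B [cB Bo BV]] := D0 A.
  apply: continuous_compact => //; apply: continuous_subspaceT.
  apply/continuousP => _ [V oV <-].
  by have /continuousP := singleCL_continuous; apply.
have [|W WB] := countable_range cB.
  by have [|//|U BU _] := BV setT; [exact: openT|exists U].
exists (fun n y z => W n (pair_le2 y z)); split.
- move=> n c Cc; have /Bo[[V oV VW] AW] : B (W n) by rewrite -WB; exists n.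
  have Vc : V (pairCL c c).
    suff : (val @^-1` V) (pair_le2 c c) by [].
    by rewrite VW; apply: AW; exists c.
  have [U [K [Uc cK Kc UK]]] := nbhs_singleCL (open_nbhs_nbhs (conj oV Vc)).
  exists U, K; split => // y z Uyz Ky Kz; rewrite -VW; apply: UK.
    by case: Uyz => ?; [exists y; split=> //; left|exists z; split=> //; right].
  by move=> t [] ->.
- move=> V oV CV; have [||U BU UV] := BV (val @^-1` V).
  + by exists V.
  + by move=> _ [c Cc <-]; exact: CV.
  + have [n _ nU] : range W U by rewrite WB.
    by exists n => y z; rewrite nU => /UV.
Qed.

End pairs.

(** * Local compactness and second countability from [F_2(X)] *)

Lemma compact_cvg_range (T : topologicalType) (u : nat -> T) (y : T) :
  u @ \oo --> y -> compact (y |` range u).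
Proof.
move=> uy; rewrite compact_ultra => F UF FS.
have [Fy|nFy] := pselect (F --> y); first by exists y; split => //; left.
have [U [Uy nFU]] : exists U, nbhs y U /\ ~ F U.
  apply: contrapT => nex; apply: nFy => U Uy; apply: contrapT => nFU.
  by apply: nex; exists U.
have [N _ uN] := uy U Uy.
have cN : compact (u @` `I_N) by apply/finite_compact/finite_image/finite_II.
have FN : F (u @` `I_N).
  have [//|FnU] := in_ultra_setVsetC U UF.
  apply: filterS (filterI FS FnU) => _ [[->|[n _ <-]] nU].
    by case: nU; exact: nbhs_singleton.
  exists n => //=; rewrite ltnNge; apply/negP => Nn; exact/nU/uN.
move: cN; rewrite compact_ultra => /(_ F UF FN)[z [[n _ <-] Fz]].
by exists (u n); split=> //; right; exists n.
Qed.

(** If the complement of [x] is hemicompact through [K] and [y != x] has a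
    countable local base, then some [K n] is a neighbourhood of [y]. *)
Lemma hemicompact_nbhs (T : topologicalType) (x y : T) (V K : nat -> set T) :
  accessible_space T -> y != x ->
  (forall n, open_nbhs y (V n)) ->
  (forall O, open_nbhs y O -> exists n, V n `<=` O) ->
  (forall n, compact (K n) /\ ~ K n x) ->
  (forall L, compact L -> ~ L x -> exists n, L `<=` K n) ->
  exists n, nbhs y (K n).
Proof.
move=> T1 yx Vy VO cK LK; apply: contrapT => nK.
pose L n := \bigcup_(i < n.+1) K i.
have cL n : compact (L n).
  rewrite /L bigcup_mkord; apply: bigsetU_compact => i _; exact: (cK i).1.
have Lx n : ~ L n x by move=> [i _]; exact: (cK i).2.
have nL n : ~ nbhs y (L n).
  have [m Lm] := LK _ (cL n) (@Lx n).
  by move=> Ly; apply: nK; exists m; exact: filterS Lm Ly.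
pose W n := (\bigcap_(i < n.+1) V i) `\` [set x].
have oW n : open_nbhs y (W n).
  split; last by split=> [i _|/= yE]; [exact: (Vy i).2|rewrite yE eqxx in yx].
  apply: openI; first by apply: open_bigcap_ltn => i; exact: (Vy i).1.
  by rewrite openC; exact: accessible_closed_set1.
(* Otherwise points of W n outside L n form a sequence converging to y; with y
   it is a compact set missing x, hence contained in some K n. *)
have /choice[u uP] n : exists z, W n z /\ ~ L n z.
  apply: contrapT => nex; apply: (@nL n); move: (open_nbhs_nbhs (oW n)).
  by apply: filterS => z Wz; apply: contrapT => nLz; apply: nex; exists z.
have uy : u @ \oo --> y.
  move=> O; rewrite nbhsE => -[P oP PO]; have [m mP] := VO P oP.
  exists m => // n /= mn; apply/PO/mP; have [[Wu _] _] := uP n.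
  exact: Wu.
have [|n nS] := LK _ (compact_cvg_range uy).
  move=> [xy|[n _ ux]]; first by rewrite xy eqxx in yx.
  by have [[_ /(_ ux)]] := uP n.
have [_] := uP n; apply; exists n => //=; apply: nS; right; by exists n.
Qed.

Section from_pairs.
Variable X : topologicalType.
Hypotheses (XT1 : @accessible_space X) (XT2 : hausdorff_space X).
Hypothesis D0F2 : D0_space (set_type (@le2_hyper X)).

(** At a single point [x]: a countable local base of [x], and a sequence of
    compact sets exhausting the compact subsets of the complement of [x]. For
    the latter, [{x, y}] with [y] outside [K n] hits every neighbourhood of [x]
    and misses [K n], so it lies in the [n]-th basic set. *)
Lemma D0_pair_point_base (x : X) : exists V K : nat -> set X,
  [/\ forall n, open_nbhs x (V n),
      forall O, open_nbhs x O -> exists n, V n `<=` O,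
      forall n, compact (K n) /\ ~ K n x &
      forall L, compact L -> ~ L x -> exists n, L `<=` K n].
Proof.
have [N [NU NV]] := D0_pair_base XT1 XT2 D0F2 (@compact_set1 _ x).
have /choice[U /choice[K UK]] n := NU n x erefl.
exists (fun n => U n `\` K n), K; split.
- move=> n; have [[oU Ux] cK Kx _] := UK n; split=> //; apply: openI => //.
  by rewrite openC; exact: compact_closed.
- move=> O [oO Ox]; have [_ ->|n nO] := NV _ (open_hit oO).
    by exists x; split=> //; left.
  exists n => y [Uy Ky]; have [_ _ _ Nn] := UK n.
  by have [z [/= [] ->]] := nO _ _ (Nn y y (or_introl Uy) Ky Ky).
- by move=> n; have [_ cK Kx _] := UK n.
- move=> L cL Lx; have [_ ->|n nL] := NV _ (open_miss cL).
    by move=> z [] ->.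
  exists n => y Ly; apply: contrapT => Ky; have [[_ Ux] _ Kx Nn] := UK n.
  by apply: (nL _ _ (Nn x y (or_introl Ux) Kx Ky)) Ly; right.
Qed.

(** On a compact set [C], finitely many open sets that are small for the [n]-th
    relation cover [C]; together they trace a countable base on [C]. *)
Lemma D0_pair_compact_base (C : set X) : compact C ->
  exists2 B : set (set X), countable B & (B `<=` open) /\
    forall x O, C x -> open_nbhs x O ->
      exists U, [/\ B U, U x & U `&` C `<=` O].
Proof.
move=> cC; have [N [NU NV]] := D0_pair_base XT1 XT2 D0F2 cC.
have /choice[U UP] n : exists U : X -> set X, forall c, C c ->
    open_nbhs c (U c) /\ forall y z, U c y -> U c z -> N n y z.
  suff /choice : forall c, exists Uc : set X, C c ->
    open_nbhs c Uc /\ forall y z, Uc y -> Uc z -> N n y z.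
    by move=> [U UC]; exists U.
  move=> c.
  have [Cc|nCc] := pselect (C c); last by exists setT.
  have [U [K [[oU Uc] cK Kc UK]]] := NU n c Cc; exists (U `\` K) => _; split.
    split=> //; apply: openI => //.
    by rewrite openC; exact: compact_closed.
  by move=> y z [Uy Ky] [Uz Kz]; apply: UK => //; left.
have /choice[s sP] n := compact_pointwise_cover cC (fun c Cc => (UP n c Cc).1).
exists (\bigcup_n [set U n c | c in [set` s n]]).
  apply: bigcup_countable => // n _.
  by apply: finite_set_countable; apply: finite_image; exact: finite_seq.
split=> [_ [n _ [c /= cs <-]]|x O Cx [oO Ox]].
  by have [sC _] := sP n; have [[]] := UP n c (sC c cs).
have cCO : compact (C `\` O).
  by apply: compact_closedI => //; exact: open_closedC.
(* This open set contains every {c} with c in C. If it contains {x, z} with z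
   in C, then z is in O, since {x, z} does not miss {x}. *)
have oV : open (miss [set x] `|` miss (C `\` O)).
  by apply: openU; apply: open_miss => //; exact: compact_set1.
have [c Cc|n nV] := NV _ oV.
  have [->|cx] := pselect (c = x); last by left=> z [] -> cx'; apply: cx.
  by right=> z [] -> [].
have [sC Cs] := sP n; have [c cs Ucx] := Cs x Cx.
exists (U n c); split=> //; first by exists n => //; exists c.
move=> z [Ucz Cz]; have [_ UN] := UP n c (sC c cs).
have [nx|nCO] := nV _ _ (UN _ _ Ucx Ucz).
  by case: (nx x (or_introl erefl)).
by apply: contrapT => nOz; apply: (nCO z (or_intror erefl)).
Qed.

(** Two distinct points provide two exhausting sequences, whose interiors
    together cover [X]. *)
Lemma D0_pair_compact_cover : exists K : nat -> set X,
  (forall n, compact (K n)) /\ (forall x : X, exists n, nbhs x (K n)).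
Proof.
have [[x [y xy]]|X1] := pselect (exists x y : X, x != y); last first.
  exists (fun=> setT); split=> [_|x]; last by exists 0%N; exact: filterT.
  have [[x _]|X0] := pselect (exists x : X, True); last first.
    rewrite (_ : setT = set0); first exact: compact0.
    by rewrite -subset0 => x _; apply: X0; exists x.
  rewrite (_ : setT = [set x]); first exact: compact_set1.
  apply/seteqP; split=> // z _ /=; apply: contrapT => /eqP zx.
  by apply: X1; exists z, x.
have [_ [K [_ _ cK LK]]] := D0_pair_point_base x.
have [_ [K' [_ _ cK' LK']]] := D0_pair_point_base y.
exists (fun n => K n `|` K' n); split=> [n|z].
  by apply: compactU; [exact: (cK n).1|exact: (cK' n).1].
have [V [_ [Vz VO _ _]]] := D0_pair_point_base z.
have [zx|zx] := eqVneq z x.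
  have zy : z != y by rewrite zx.
  have [n nz] := hemicompact_nbhs XT1 zy Vz VO cK' LK'.
  by exists n; apply: filterS nz => t; right.
have [n nz] := hemicompact_nbhs XT1 zx Vz VO cK LK.
by exists n; apply: filterS nz => t; left.
Qed.

Lemma D0_pair_second_countable : @second_countable X.
Proof.
have [K [cK Kn]] := D0_pair_compact_cover.
have /choice[B BP] n : exists B : set (set X), [/\ countable B, B `<=` open &
    forall x O, K n x -> open_nbhs x O ->
      exists U, [/\ B U, U x & U `&` K n `<=` O]].
  by have [B cB [Bo BO]] := D0_pair_compact_base (cK n); exists B.
exists (\bigcup_n [set U `&` (K n)° | U in B n]).
  apply: bigcup_countable => // n _; have [cB _ _] := BP n.
  exact: sub_countable (card_image_le _ _) cB.
split=> [_ [n _ [U BU <-]]|x O].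
  by apply: openI; [have [_ + _] := BP n; apply|exact: open_interior].
rewrite nbhsE => -[P oP PO]; have [n nx] := Kn x.
have [_ _ /(_ x P (nbhs_singleton nx) oP)[U [BU Ux UP]]] := BP n.
exists (U `&` (K n)°) => /=; first by split => //; exists n => //; exists U.
by move=> z [Uz /interior_subset Kz]; apply/PO/UP.
Qed.

Lemma D0_pair_locally_compact : locally_compact [set: X].
Proof.
have [K [cK Kn]] := D0_pair_compact_cover.
move=> x _; have [n nx] := Kn x; exists (K n).
  by apply: filterS nx => z Kz _.
by split=> //; exact: compact_closed.
Qed.

End from_pairs.

(** * Metrizability of second countable locally compact spaces *)

(** Continuous [0, 1]-valued functions vanishing at infinity, in the sense that
    their positive superlevel sets are compact. *)
Definition bump (R : realType) (X : topologicalType) (f : X -> R) :=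
  [/\ forall x, 0 <= f x <= 1, continuous f &
      forall a, 0 < a -> compact [set x | a <= f x]].

Lemma closed_superlevel (R : realType) (X : topologicalType) (f : X -> R) a :
  continuous f -> closed [set x | a <= f x].
Proof.
move=> /continuous_closedP fc.
by apply: (fc [set y | a <= y]); exact: closed_ge.
Qed.

Lemma open_superlevel (R : realType) (X : topologicalType) (f : X -> R) a :
  continuous f -> open [set x | a < f x].
Proof.
move=> /continuousP fc.
by apply: (fc [set y | a < y]); exact: open_gt.
Qed.

Lemma locally_compact_bump (R : realType) (X : topologicalType) (x : X) O :
  locally_compact [set: X] -> hausdorff_space X -> open_nbhs x O ->
  exists f : X -> R, [/\ bump f, f x = 1 & forall y, ~ O y -> f y = 0].
Proof.
move=> lcX X2 [oO Ox].
have [K xK [cK clK]] := lcX x I.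
have Kx : nbhs x K by move: xK; rewrite /within/=; apply: filterS => z; exact.
pose P := O `&` K°.
have oP : open P by apply: openI => //; exact: open_interior.
have nP : ~ (~` P) x by apply; split.
have /(@uniform_separatorP _ R) [f [fc f01 fx fP]] :=
  @locally_compact_completely_regular X R lcX X2 x _ (open_closedC oP) nP.
have f1 y : ~ P y -> f y = 1 by move=> nPy; apply: fP; exists y.
exists (fun y => 1 - f y); split.
- split.
  + move=> y; have : `[0, 1]%classic (f y) by apply: f01; exists y.
    by rewrite /= in_itv/=; lra.
  + by move=> y; apply: cvgB; [exact: cvg_cst|exact: fc].
  + move=> a a0; apply: (subclosed_compact _ cK).
      apply: closed_superlevel => y; apply: cvgB; [exact: cvg_cst|exact: fc].
    move=> y /= ay; apply: contrapT => nKy.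
    have : ~ P y by move=> [_ /interior_subset].
    by move=> /f1 fy; move: ay; rewrite fy subrr leNgt a0.
- by rewrite (fx (f x)) ?subr0//; exists x.
- by move=> y nOy; rewrite f1 ?subrr// => -[].
Qed.

Lemma countable_bumps (R : realType) (X : topologicalType) :
  locally_compact [set: X] -> hausdorff_space X -> @second_countable X ->
  exists f : nat -> X -> R, (forall n, bump (f n)) /\
    forall x O, open_nbhs x O ->
      exists n, 2^-1 < f n x /\ forall y, ~ O y -> f n y = 0.
Proof.
move=> lcX X2 [B cB [Bo Bx]].
(* Index by pairs (U, V) of basic open sets that some bump function separates:
   only countably many functions are kept. *)
pose good (UV : set X * set X) (f : X -> R) := [/\ bump f,
  forall x, UV.1 x -> 2^-1 < f x & forall y, ~ UV.2 y -> f y = 0].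
have bump0 : bump (fun _ : X => 0 : R).
  split => [x|x|a a0]; [by rewrite lexx ler01|exact: cvg_cst|].
  rewrite (_ : mkset _ = set0); first exact: compact0.
  by rewrite -subset0 => x /=; rewrite leNgt a0.
have /choice[h hP] UV : exists f,
    bump f /\ ((exists g, good UV g) -> good UV f).
  have [[g gg]|ng] := pselect (exists g, good UV g).
    by exists g; split => //; have [] := gg.
  by exists (fun _ : X => 0).
have [u uE] : exists u : nat -> X -> R, range u = (fun=> 0) |` (h @` (B `*` B)).
  apply: countable_range; last by exists (fun=> 0); left.
  rewrite -bigcup2E; apply: bigcup_countable => // -[_|[_|n _]] /=.
  - exact: finite_set_countable.
  - exact: sub_countable (card_image_le _ _) (countableX cB cB).
  - exact: finite_set_countable.
exists u; split.
  move=> n; have : range u (u n) by exists n.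
  by rewrite uE => -[->//|[UV _ <-]]; have [] := hP UV.
move=> x O xO.
have [V [BV Vx] VO] := Bx x O (open_nbhs_nbhs xO).
have [g [bg gx gV]] := @locally_compact_bump R X x V lcX X2 (conj (Bo _ BV) Vx).
have [_ gc _] := bg.
have [|U [BU Ux] Ug] := Bx x [set y | 2^-1 < g y].
  by apply: open_nbhs_nbhs; split; [exact: open_superlevel|rewrite /= gx; lra].
have [_ [|_ hU hV]] := hP (U, V); first by exists g; split.
have [n _ nE] : range u (h (U, V)) by rewrite uE; right; exists (U, V).
by exists n; rewrite nE; split=> [|y nOy]; [exact: hU|apply: hV => /VO].
Qed.

Lemma metrizable_of_lcsc (R : realType) (X : topologicalType) :
  locally_compact [set: X] -> hausdorff_space X -> @second_countable X ->
  metrizable R X.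
Proof.
move=> lcX X2 X3; have [f [fb fO]] := @countable_bumps R X lcX X2 X3.
apply: (@metrizable_of_functions R X f (hausdorff_accessible X2)).
- by move=> n; have [] := fb n.
- by move=> n; have [] := fb n.
move=> x V; rewrite nbhsE => -[O xO OV]; have [n [nx nO]] := fO x O xO.
exists n.+1, 2^-1; split; first by rewrite invr_gt0.
move=> y /(_ n (ltnSn n)) fxy; apply/OV; apply: contrapT => /nO fy0.
by move: fxy; rewrite fy0 subr0 ltr_norml; lra.
Qed.

Section fell_coordinates.
Variables (R : realType) (X : topologicalType) (f : nat -> X -> R).
Hypothesis fb : forall n, bump (f n).
Hypothesis fO : forall x O, open_nbhs x O ->
  exists n, 2^-1 < f n x /\ forall y, ~ O y -> f n y = 0.

(** The coordinate function [H |-> sup_H (f n)] on the hyperspace. *)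
Definition sup_on n (H : CL X) : R := sup (f n @` \val H).

Let f01 n x : 0 <= f n x <= 1. Proof. by have [] := fb n. Qed.

Let f_neq0 n (H : CL X) : f n @` \val H !=set0.
Proof. by have [x Hx] := CL_neq0 H; exists (f n x), x. Qed.

Lemma sup_on_ge n (H : CL X) x : \val H x -> f n x <= sup_on n H.
Proof.
move=> Hx; suff /ub_le_sup : has_ubound (f n @` \val H) by apply; exists x.
by exists 1 => _ [y _ <-]; have /andP[] := f01 n y.
Qed.

Lemma sup_on_le n (H : CL X) a :
  (forall x, \val H x -> f n x <= a) -> sup_on n H <= a.
Proof. by move=> Ha; apply: ge_sup => // _ [x Hx <-]; exact: Ha. Qed.

Lemma sup_on_gt n (H : CL X) a :
  a < sup_on n H -> exists2 x, \val H x & a < f n x.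
Proof. by move/(sup_gt (f_neq0 n H)) => -[_ [x Hx <-] ax]; exists x. Qed.

Lemma sup_on_continuous n : continuous (sup_on n).
Proof.
have [_ fc fK] := fb n.
move=> H; apply/(@cvgrPdist_lt _ R^o _ _ (nbhs_filter H)) => e e0.
have nK : nbhs H (miss [set x | sup_on n H + e / 2 <= f n x]).
  apply: open_nbhs_nbhs; split.
    apply: open_miss; apply: fK; rewrite ltr_wpDl ?divr_gt0//.
    have [x Hx] := CL_neq0 H; apply: le_trans (sup_on_ge n Hx).
    by have /andP[] := f01 n x.
  move=> x /(sup_on_ge n) Hx /=; apply/negP; rewrite -ltNge.
  by apply: le_lt_trans Hx _; rewrite ltrDl divr_gt0.
have nU : nbhs H (hit [set x | sup_on n H - e < f n x]).
  apply: open_nbhs_nbhs; split.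
    by apply: open_hit; exact: open_superlevel.
  have [|x Hx fx] := @sup_on_gt n H (sup_on n H - e); last by exists x.
  by rewrite ltrBlDr ltrDl.
suff : nbhs H [set H' | `|sup_on n H - sup_on n H'| < e] by [].
apply: (@filterS _ _ (nbhs_filter H) _ _ _ (filterI nK nU)).
move=> H' [H'K [x [/(sup_on_ge n) H'x /= fx]]] /=.
have : sup_on n H' <= sup_on n H + e / 2.
  by apply: sup_on_le => y /H'K /= /negP; rewrite -ltNge => /ltW.
by rewrite ltr_norml; lra.
Qed.

(** The coordinate functions generate the Fell topology. *)
Lemma sup_on_nbhs (H : CL X) V : nbhs H V -> exists N e, 0 < e /\
  forall H', (forall n, (n < N)%N -> `|sup_on n H - sup_on n H'| < e) -> V H'.
Proof.
pose F := [set V : set (CL X) | exists N e, 0 < e /\ forall H',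
  (forall n, (n < N)%N -> `|sup_on n H - sup_on n H'| < e) -> V H'].
apply: (@fell_nbhs_sub X H F).
- split.
  + by exists 0%N, 1; split.
  + move=> P Q [N [e [e0 NP]]] [M [d [d0 MQ]]].
    exists (maxn N M), (Num.min e d); split; first by rewrite lt_min e0.
    move=> H' NM; split; [apply: NP => n nN|apply: MQ => n nM].
      by have := NM n; rewrite leq_max nN lt_min => /(_ isT)/andP[].
    by have := NM n; rewrite leq_max nM orbT lt_min => /(_ isT)/andP[].
  + by move=> P Q PQ [N [e [e0 NP]]]; exists N, e; split=> // H' /NP /PQ.
- move=> U oU [x [Hx Ux]]; have [n [nx nU]] := fO (conj oU Ux).
  exists n.+1, 2^-1; split; first by rewrite invr_gt0.
  move=> H' /(_ n (ltnSn n)) HH'; have := sup_on_ge n Hx => fxH.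
  have [|y H'y fy] := @sup_on_gt n H' 0.
    by move: HH'; rewrite ltr_norml; lra.
  exists y; split => //; apply: contrapT => /nU fy0.
  by rewrite fy0 ltxx in fy.
- move=> K cK HK.
  (* Among finitely many functions vanishing on H, one exceeds 1 / 2 at each
     point of K; a set on which their suprema stay below 1 / 2 misses K. *)
  have /choice[n nP] y : exists n, K y ->
      2^-1 < f n y /\ forall x, \val H x -> f n x = 0.
    have [Ky|nKy] := pselect (K y); last by exists 0%N.
    have [|n [ny nH]] := @fO y (~` \val H).
      by split; [rewrite openC; exact: CL_closed|move=> /HK; apply].
    by exists n => _; split=> // x Hx; apply: nH; apply.
  have [|s [sK Ks]] := @compact_pointwise_cover _ K
      (fun y => [set z | 2^-1 < f (n y) z]) cK.
    move=> y Ky; split; last exact: (nP y Ky).1.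
    by apply: open_superlevel; have [] := fb (n y).
  exists (\max_(y <- s) n y).+1, 2^-1; split; first by rewrite invr_gt0.
  move=> H' HH' z H'z Kz; have [y ys /= yz] := Ks z Kz.
  have nyN : (n y < (\max_(y <- s) n y).+1)%N by rewrite ltnS leq_bigmax_seq.
  have [_ fH0] := nP y (sK y ys).
  have phi0 : sup_on (n y) H <= 0 by apply: sup_on_le => x /fH0 ->.
  by have := sup_on_ge (n y) H'z; have := HH' _ nyN; rewrite ltr_norml; lra.
Qed.

Lemma sup_on01 n (H : CL X) : 0 <= sup_on n H <= 1.
Proof.
apply/andP; split; last by apply: sup_on_le => x _; have /andP[] := f01 n x.
have [x Hx] := CL_neq0 H; apply: le_trans (sup_on_ge n Hx).
by have /andP[] := f01 n x.
Qed.

End fell_coordinates.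

Lemma fell_metrizable (R : realType) (X : topologicalType) :
  locally_compact [set: X] -> hausdorff_space X -> @second_countable X ->
  metrizable R (CL X).
Proof.
move=> lcX X2 X3; have [f [fb fO]] := @countable_bumps R X lcX X2 X3.
apply: (@metrizable_of_functions R (CL X) (sup_on f) (@CL_accessible X)).
- exact: sup_on01.
- exact: sup_on_continuous.
- exact: sup_on_nbhs.
Qed.

Lemma second_countable_separable (T : topologicalType) :
  @second_countable T -> separable T.
Proof.
move=> [B cB [Bo Bx]].
have [[t _]|T0] := pselect (exists t : T, True); last first.
  by exists set0; [exact: countable0|move=> O [t _]; case: T0; exists t].
have /choice[c cP] (U : set T) : exists x, U !=set0 -> U x.
  by have [[x Ux]|U0] := pselect (U !=set0); [exists x|exists t].
exists (c @` B); first exact: sub_countable (card_image_le _ _) cB.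
move=> O [x Ox] oO.
have [U [BU Ux] UO] := Bx x O (open_nbhs_nbhs (conj oO Ox)).
exists (c U); split; last by exists U.
exact: (UO _ (cP U (ex_intro _ x Ux))).
Qed.

Lemma separable_metrizable_second_countable (R : realType)
    (T : topologicalType) :
  metrizable R T -> separable T -> @second_countable T.
Proof.
move=> /metrizableP[d [dxx _ dC dT] dE] [D cD dD].
have oball x e : open [set y | d x y < e].
  rewrite openE => y /= xy; apply/dE; exists (e - d x y); rewrite ?subr_gt0//.
  by move=> z /= yz; apply: le_lt_trans (dT y x z) _; rewrite addrC -ltrBrDr.
pose B (xn : T * nat) : set T := [set y | d xn.1 y < xn.2.+1%:R^-1].
exists (B @` (D `*` setT)).
  apply: sub_countable (card_image_le _ _) _.
  by apply: countableX => //; exact: countableP.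
split=> [_ [[x n] _ <-]|x V /dE[e e0 eV]]; first exact: oball.
have [n ne] : exists n, n.+1%:R^-1 < e / 2.
  exists (Num.bound (2 / e)); rewrite invf_plt ?posrE ?divr_gt0// invf_div.
  apply: lt_trans (archi_boundP _) _; first by rewrite divr_ge0 ?ltW.
  by rewrite ltr_nat.
have [|q [xq Dq]] := dD [set y | d x y < n.+1%:R^-1] _ (oball _ _).
  by exists x; rewrite /= dxx invr_gt0.
exists (B (q, n)) => /=.
  by split; [exists (q, n)|rewrite /B/= dC].
move=> y; rewrite /B/= => qy; apply: eV => /=.
rewrite (le_lt_trans (dT q x y))// [ltRHS]splitr.
by rewrite ltrD// ?(lt_trans xq)// (lt_trans qy).
Qed.

(** * The equivalence *)

Theorem theorem3p1 (R : realType) (X : topologicalType)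
    (X_regular : regular_space X) (X_T1 : @accessible_space X) :
  [<-> metrizable R (CL X);
       gamma_space (CL X);
       D0_space (CL X);
       D0_space (set_type (@compact_hyper X));
       D0_space (set_type (@finite_hyper X));
       D0_space (set_type (@le2_hyper X));
       [/\ locally_compact [set: X], separable X & metrizable R X]].
Proof.
have X2 := regular_T1_hausdorff X_regular X_T1.
tfae.
- exact: metrizable_gamma.
- exact: gamma_D0.
- exact: D0_set_type.
- by apply: D0_set_typeS => H; exact: finite_compact.
- apply: D0_set_typeS => H; rewrite /le2_hyper /finite_hyper /= => H2.
  exact: card_le_finite H2 (finite_II 2).
- move=> D0; have lcX := D0_pair_locally_compact X_T1 X2 D0.
  have X3 := D0_pair_second_countable X_T1 X2 D0.
  split=> //; first exact: second_countable_separable.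
  exact: metrizable_of_lcsc.
- move=> [lcX sX mX]; apply: fell_metrizable => //.
  exact: separable_metrizable_second_countable mX sX.
Qed.
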